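(* The merging space functor $\mathbb{P}^+:\mathbf{Flow}\longrightarrow\mathbf{Top}$ is a left Quillen functor.
   Context: $\mathbf{Top}$ is the category of compactly generated topological spaces (weak Hausdorff $k$-spaces), with the model structure whose weak equivalences are the weak homotopy equivalences and whose fibrations are the Serre fibrations. A flow $X$ consists of a compactly generated space $\mathbb{P}X$ (the path space), a discrete space $X^0$ (the set of states), continuous maps $s,t:\mathbb{P}X\to X^0$, and a continuous associative map $*:\{(x,y)\in\mathbb{P}X\times\mathbb{P}X;\ t(x)=s(y)\}\to\mathbb{P}X$ with $s(x*y)=s(x)$ and $t(x*y)=t(y)$. A morphism of flows $f:X\to Y$ consists of a set map $f^0:X^0\to Y^0$ and a continuous map $\mathbb{P}f:\mathbb{P}X\to\mathbb{P}Y$ compatible with $s$, $t$ and $*$. The category of flows is $\mathbf{Flow}$. It carries a unique model structure such that: the weak equivalences are the weak S-homotopy equivalences, i.e. the morphisms $f$ with $f^0$ a bijection and $\mathbb{P}f$ a weak homotopy equivalence; the fibrations are the morphisms $f$ with $\mathbb{P}f$ a Serre fibration. (This model structure may be taken as known.) The merging space $\mathbb{P}^+X$ of a flow $X$ is the compactly generated space equipped with a continuous map $h^+:\mathbb{P}X\to\mathbb{P}^+X$ that is universal among continuous maps $\phi$ from $\mathbb{P}X$ to compactly generated spaces with $\phi(y)=\phi(x*y)$ whenever $t(x)=s(y)$. The assignment $X\mapsto\mathbb{P}^+X$ is a functor. A left Quillen functor is a functor between model categories that has a right adjoint and preserves cofibrations and trivial cofibrations. *)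

(* Defs.v *)
From HB Require Import structures.
From mathcomp Require Import all_boot all_order all_algebra.
From mathcomp Require Import all_classical all_reals.
From mathcomp Require Import topology normedtype.

Set Implicit Arguments.
Unset Strict Implicit.
Unset Printing Implicit Defensive.

Import Order.TTheory GRing.Theory Num.Theory.
Import numFieldNormedType.Exports.

Local Open Scope classical_set_scope.
Local Open Scope ring_scope.

Record category := Category {
  ob :> Type;
  mor : ob -> ob -> Type;
  idc : forall a, mor a a;
  compc : forall a b c, mor b c -> mor a b -> mor a c;
  compc1 : forall a b (f : mor a b), compc f (idc a) = f;
  comp1c : forall a b (f : mor a b), compc (idc b) f = f;
  compcA : forall a b c d (h : mor c d) (g : mor b c) (f : mor a b),
    compc h (compc g f) = compc (compc h g) f
}.

Arguments mor {_} _ _.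
Arguments idc {_} _.
Arguments compc {_ _ _ _} _ _.

Record functor (C D : category) := Functor {
  fob :> C -> D;
  fhom : forall a b : C, mor a b -> mor (fob a) (fob b);
  fhom1 : forall a, fhom (idc a) = idc (fob a);
  fhomM : forall (a b c : C) (g : mor b c) (f : mor a b),
    fhom (compc g f) = compc (fhom g) (fhom f)
}.

Arguments fhom {_ _} _ {_ _} _.

Record adjunction (C D : category) (F : functor C D) (G : functor D C) :=
  Adjunction {
  adj : forall (a : C) (b : D), mor (F a) b -> mor a (G b);
  adj_bij : forall a b, bijective (@adj a b);
  adj_natl : forall (a' a : C) (b : D) (h : mor (F a) b) (f : mor a' a),
    adj (compc h (fhom F f)) = compc (adj h) f;
  adj_natr : forall (a : C) (b b' : D) (h : mor (F a) b) (k : mor b b'),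
    adj (compc k h) = compc (fhom G k) (adj h)
}.

Definition has_right_adjoint (C D : category) (F : functor C D) : Prop :=
  exists G : functor D C, inhabited (adjunction F G).

Definition mor_class (C : category) := forall a b : C, mor a b -> Prop.

Definition retract_of (C : category) (a b c d : C) (f : mor a b) (g : mor c d) :=
  exists (i : mor a c) (r : mor c a) (j : mor b d) (q : mor d b),
    [/\ compc r i = idc a, compc q j = idc b,
        compc g i = compc j f & compc f r = compc q g].

Definition retract_closed (C : category) (W : mor_class C) : Prop :=
  forall (a b c d : C) (f : mor a b) (g : mor c d),
    retract_of f g -> W c d g -> W a b f.

Definition has_lifting (C : category) (a b c d : C)
    (i : mor a b) (p : mor c d) : Prop :=
  forall (u : mor a c) (v : mor b d), compc p u = compc v i ->
    exists l : mor b c, compc l i = u /\ compc p l = v.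

(* Quillen's axioms for the three classes.  The existence of limits and
   colimits is a property of the underlying category and is not a part of this
   record; factorizations are not required to be functorial. *)
Record model_structure (C : category) := ModelStructure {
  weq : mor_class C;
  cof : mor_class C;
  fib : mor_class C;
  weq_comp : forall a b c (f : mor a b) (g : mor b c),
    weq f -> weq g -> weq (compc g f);
  weq_cancell : forall a b c (f : mor a b) (g : mor b c),
    weq g -> weq (compc g f) -> weq f;
  weq_cancelr : forall a b c (f : mor a b) (g : mor b c),
    weq f -> weq (compc g f) -> weq g;
  weq_retract : retract_closed weq;
  cof_retract : retract_closed cof;
  fib_retract : retract_closed fib;
  cof_tfib_lift : forall a b c d (i : mor a b) (p : mor c d),
    cof i -> fib p -> weq p -> has_lifting i p;
  tcof_fib_lift : forall a b c d (i : mor a b) (p : mor c d),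
    cof i -> weq i -> fib p -> has_lifting i p;
  cof_tfib_fact : forall a b (f : mor a b),
    exists (c : C) (i : mor a c) (p : mor c b),
      [/\ f = compc p i, cof i, fib p & weq p];
  tcof_fib_fact : forall a b (f : mor a b),
    exists (c : C) (i : mor a c) (p : mor c b),
      [/\ f = compc p i, cof i, weq i & fib p]
}.

Arguments weq {_} _ {_ _} _.
Arguments cof {_} _ {_ _} _.
Arguments fib {_} _ {_ _} _.

Definition left_Quillen (C D : category) (M : model_structure C)
    (N : model_structure D) (F : functor C D) : Prop :=
  [/\ has_right_adjoint F,
      forall (a b : C) (f : mor a b), cof M f -> cof N (fhom F f) &
      forall (a b : C) (f : mor a b),
        cof M f -> weq M f -> cof N (fhom F f) /\ weq N (fhom F f)].

Definition compact_hausdorff (K : topologicalType) : Prop :=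
  compact [set: K] /\ hausdorff_space K.

Definition k_open (X : topologicalType) (A : set X) : Prop :=
  forall (K : topologicalType) (u : K -> X),
    compact_hausdorff K -> continuous u -> open (u @^-1` A).

Definition is_kspace (X : topologicalType) : Prop :=
  forall A : set X, k_open A -> open A.

Definition weak_hausdorff (X : topologicalType) : Prop :=
  forall (K : topologicalType) (u : K -> X),
    compact_hausdorff K -> continuous u -> closed (range u).

(* X with the final topology with respect to all continuous maps from compact
   Hausdorff spaces *)
Definition kification (X : Type) : Type := X.

Section Kification.
Variable X : topologicalType.

Let k_openT : k_open [set: X].
Proof. by move=> K u _ _; rewrite preimage_setT; exact: openT. Qed.

Let k_openI : setI_closed (@k_open X).
Proof. by move=> A B oA oB K u hK cu; apply: openI; [exact: oA|exact: oB]. Qed.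

Let k_open_bigcup (I : Type) (f : I -> set X) :
  (forall i, k_open (f i)) -> k_open (\bigcup_i f i).
Proof.
move=> of_ K u hK cu; rewrite preimage_bigcup.
by apply: bigcup_open => i _; exact: of_.
Qed.

HB.instance Definition _ := Choice.on (kification X).
HB.instance Definition _ :=
  @isOpenTopological.Build (kification X) (@k_open X)
    k_openT k_openI k_open_bigcup.

Lemma kification_openE (A : set (kification X)) : open A = k_open (A : set X).
Proof. by []. Qed.
End Kification.

Record cg_space := CGSpace {
  cg_carrier :> topologicalType;
  cg_kspace : is_kspace cg_carrier;
  cg_weak_hausdorff : weak_hausdorff cg_carrier
}.

Definition cts_comp (X Y Z : topologicalType) (g : continuousType Y Z)
    (f : continuousType X Y) : continuousType X Z :=
  [the continuousType X Z of g \o f].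

Definition cts_id (X : topologicalType) : continuousType X X :=
  [the continuousType X X of @idfun X].

Lemma cts_comp1 (X Y : topologicalType) (f : continuousType X Y) :
  cts_comp f (cts_id X) = f.
Proof. exact/continuousEP. Qed.

Lemma cts_1comp (X Y : topologicalType) (f : continuousType X Y) :
  cts_comp (cts_id Y) f = f.
Proof. exact/continuousEP. Qed.

Lemma cts_compA (X Y Z T : topologicalType) (h : continuousType Z T)
    (g : continuousType Y Z) (f : continuousType X Y) :
  cts_comp h (cts_comp g f) = cts_comp (cts_comp h g) f.
Proof. exact/continuousEP. Qed.

Definition Top : category :=
  @Category cg_space (fun X Y => continuousType X Y)
    (fun X => cts_id X) (fun X Y Z g f => cts_comp g f)
    (fun X Y f => cts_comp1 f) (fun X Y f => cts_1comp f)
    (fun X Y Z T h g f => cts_compA h g f).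

Section Homotopy.
Variable R : realType.

Definition Itv : set R := `[0, 1].

Lemma Itv0_subproof : (0 : R) \in Itv.
Proof. by rewrite inE /Itv /= in_itv /= lexx ler01. Qed.

Lemma Itv1_subproof : (1 : R) \in Itv.
Proof. by rewrite inE /Itv /= in_itv /= lexx ler01. Qed.

Definition Itv0 : Itv := exist _ 0 Itv0_subproof.
Definition Itv1 : Itv := exist _ 1 Itv1_subproof.

Definition cube (n : nat) : set 'rV[R]_n :=
  [set c | forall i, 0 <= c ord0 i <= 1].

Arguments cube n _ : clear implicits.

Definition cube_boundary (n : nat) (c : cube n) : Prop :=
  exists i, \val c ord0 i = 0 \/ \val c ord0 i = 1.

Definition path_connected_to (X : topologicalType) (x y : X) : Prop :=
  exists p : continuousType Itv X, p Itv0 = x /\ p Itv1 = y.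

(* the maps of pairs (I^n, dI^n) -> (X, x) *)
Definition nloop (n : nat) (X : topologicalType) (x : X) : Type :=
  {p : continuousType (cube n) X | forall c, cube_boundary c -> p c = x}.

Definition nloop_homotopic (n : nat) (X : topologicalType) (x : X)
    (p q : nloop n x) : Prop :=
  exists H : continuousType (cube n * Itv)%type X,
    [/\ forall c, H (c, Itv0) = sval p c,
        forall c, H (c, Itv1) = sval q c &
        forall c t, cube_boundary c -> H (c, t) = x].

Lemma nloop_map_subproof (n : nat) (X Y : topologicalType)
    (f : continuousType X Y) (x : X) (p : nloop n x) (c : cube n) :
  cube_boundary c -> cts_comp f (sval p) c = f x.
Proof. by move=> bc /=; rewrite (svalP p). Qed.

Definition nloop_map (n : nat) (X Y : topologicalType)
    (f : continuousType X Y) (x : X) (p : nloop n x) : nloop n (f x) :=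
  exist _ (cts_comp f (sval p)) (nloop_map_subproof f p).

(* For equivalence relations preserved by f: the map A / eA -> B / eB induced
   by f is bijective. *)
Definition quotient_bijective (A B : Type) (eA : A -> A -> Prop)
    (eB : B -> B -> Prop) (f : A -> B) : Prop :=
  (forall a a', eB (f a) (f a') -> eA a a') /\
  (forall b, exists a, eB (f a) b).

(* f is bijective on path components and on the n-th homotopy groups, for all
   n >= 1 and all base points; the induced maps on the latter are always
   homomorphisms, so that bijectivity is the only condition. *)
Definition weak_homotopy_equivalence (X Y : topologicalType)
    (f : continuousType X Y) : Prop :=
  quotient_bijective (@path_connected_to X) (@path_connected_to Y) f /\
  forall (n : nat) (x : X), (0 < n)%N ->
    quotient_bijective (@nloop_homotopic n X x) (@nloop_homotopic n Y (f x))
      (fun p => nloop_map f p).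

Definition Serre_fibration (X Y : topologicalType)
    (p : continuousType X Y) : Prop :=
  forall (n : nat) (u : continuousType (cube n) X)
         (H : continuousType (cube n * Itv)%type Y),
    (forall c, p (u c) = H (c, Itv0)) ->
    exists L : continuousType (cube n * Itv)%type X,
      (forall c, L (c, Itv0) = u c) /\ (forall z, p (L z) = H z).

End Homotopy.

Definition composable (P S : Type) (s t : P -> S) : set (P * P) :=
  [set xy | t xy.1 = s xy.2].

Definition cpair (P S : Type) (s t : P -> S) (x y : P) (e : t x = s y) :
    composable s t :=
  exist _ (x, y) (mem_set (e : composable s t (x, y))).

(* Products and subspaces are those of the category of compactly generated
   spaces, whence the k-ification on the domain of [fcat]. *)
Record flow := Flow {
  Psp : cg_space;
  states : discreteTopologicalType;
  src : continuousType Psp states;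
  tgt : continuousType Psp states;
  fcat : continuousType (kification (composable src tgt)) Psp;
  fcat_src : forall x y (e : tgt x = src y), src (fcat (cpair e)) = src x;
  fcat_tgt : forall x y (e : tgt x = src y), tgt (fcat (cpair e)) = tgt y;
  fcatA : forall x y z (exy : tgt x = src y) (eyz : tgt y = src z)
    (el : tgt (fcat (cpair exy)) = src z) (er : tgt x = src (fcat (cpair eyz))),
    fcat (cpair el) = fcat (cpair er)
}.

Arguments src {_}.
Arguments tgt {_}.
Arguments fcat {_}.

Record flow_mor (X Y : flow) := FlowMor {
  fm_states : states X -> states Y;
  fm_path : continuousType (Psp X) (Psp Y);
  fm_src : forall x, src (fm_path x) = fm_states (src x);
  fm_tgt : forall x, tgt (fm_path x) = fm_states (tgt x);
  fm_cat : forall x y (e : tgt x = src y) (e' : tgt (fm_path x) = src (fm_path y)),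
    fm_path (fcat (cpair e)) = fcat (cpair e')
}.

Lemma flow_mor_eq (X Y : flow) (f g : flow_mor X Y) :
  fm_states f = fm_states g -> fm_path f = fm_path g -> f = g.
Proof.
case: f g => [f0 Pf fs ft fc] [g0 Pg gs gt gc] /= e0 e1.
move: fs ft fc gs gt gc; rewrite {f0}e0 {Pf}e1 => fs ft fc gs gt gc.
by congr FlowMor; exact: Prop_irrelevance.
Qed.

Section FlowCategory.

Definition flow_id (X : flow) : flow_mor X X.
Proof.
refine (@FlowMor X X id (cts_id (Psp X)) _ _ _) => //= x y e e'.
by rewrite (Prop_irrelevance e e').
Defined.

Lemma fm_composable (X Y : flow) (f : flow_mor X Y) (x y : Psp X) :
  tgt x = src y -> tgt (fm_path f x) = src (fm_path f y).
Proof. by move=> e; rewrite fm_tgt fm_src e. Qed.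

Definition flow_comp (X Y Z : flow) (g : flow_mor Y Z) (f : flow_mor X Y) :
  flow_mor X Z.
Proof.
refine (@FlowMor X Z (fm_states g \o fm_states f)
  (cts_comp (fm_path g) (fm_path f)) _ _ _).
- by move=> x /=; rewrite !fm_src.
- by move=> x /=; rewrite !fm_tgt.
- by move=> x y e e' /=; rewrite (fm_cat e (fm_composable f e)); exact: fm_cat.
Defined.

Lemma flow_comp1 (X Y : flow) (f : flow_mor X Y) : flow_comp f (flow_id X) = f.
Proof. by apply: flow_mor_eq => //=; exact: cts_comp1. Qed.

Lemma flow_1comp (X Y : flow) (f : flow_mor X Y) : flow_comp (flow_id Y) f = f.
Proof. by apply: flow_mor_eq => //=; exact: cts_1comp. Qed.

Lemma flow_compA (X Y Z T : flow) (h : flow_mor Z T) (g : flow_mor Y Z)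
    (f : flow_mor X Y) :
  flow_comp h (flow_comp g f) = flow_comp (flow_comp h g) f.
Proof. by apply: flow_mor_eq => //=; exact: cts_compA. Qed.

End FlowCategory.

Definition Flows : category :=
  @Category flow flow_mor flow_id flow_comp flow_comp1 flow_1comp flow_compA.

Definition weak_S_homotopy_equivalence (R : realType) (X Y : flow)
    (f : flow_mor X Y) : Prop :=
  bijective (fm_states f) /\ weak_homotopy_equivalence R (fm_path f).

Definition flow_fibration (R : realType) (X Y : flow) (f : flow_mor X Y) : Prop :=
  Serre_fibration R (fm_path f).

Definition merging_map (X : flow) (Z : Type) (phi : Psp X -> Z) : Prop :=
  forall (x y : Psp X) (e : tgt x = src y), phi y = phi (fcat (cpair e)).

Record merging_space (X : flow) := MergingSpace {
  mg_space :> cg_space;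
  mg_h : continuousType (Psp X) mg_space;
  mg_hP : merging_map mg_h;
  mg_univ : forall (Z : cg_space) (phi : continuousType (Psp X) Z),
    merging_map phi ->
    exists! psi : continuousType mg_space Z, cts_comp psi mg_h = phi
}.

Section MergingFunctor.
Variable Pp : forall X : flow, merging_space X.

Lemma mg_map_subproof (X Y : flow) (f : flow_mor X Y) :
  merging_map (cts_comp (mg_h (Pp Y)) (fm_path f)).
Proof.
move=> x y e /=; rewrite (fm_cat e (fm_composable f e)).
exact: mg_hP.
Qed.

Definition mg_map (X Y : flow) (f : flow_mor X Y) : continuousType (Pp X) (Pp Y) :=
  projT1 (cid (mg_univ (Pp X) (mg_map_subproof f))).

Lemma mg_mapE (X Y : flow) (f : flow_mor X Y) :
  cts_comp (mg_map f) (mg_h (Pp X)) = cts_comp (mg_h (Pp Y)) (fm_path f).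
Proof. by rewrite /mg_map; case: cid => psi []. Qed.

Lemma mg_map_unique (X Y : flow) (f : flow_mor X Y)
    (psi : continuousType (Pp X) (Pp Y)) :
  cts_comp psi (mg_h (Pp X)) = cts_comp (mg_h (Pp Y)) (fm_path f) ->
  mg_map f = psi.
Proof. by rewrite /mg_map; case: cid => chi /= [_ u] /u. Qed.

Lemma mg_map1 (X : flow) : mg_map (flow_id X) = cts_id (Pp X).
Proof. by apply: mg_map_unique; rewrite cts_1comp /= cts_comp1. Qed.

Lemma mg_mapM (X Y Z : flow) (g : flow_mor Y Z) (f : flow_mor X Y) :
  mg_map (flow_comp g f) = cts_comp (mg_map g) (mg_map f).
Proof.
apply: mg_map_unique.
by rewrite -cts_compA mg_mapE cts_compA mg_mapE -cts_compA.
Qed.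

(* The functor for a given choice of the universal maps h^+; such choices exist,
   by merging_space_exists below. *)
Definition merging_functor : functor Flows Top :=
  @Functor Flows Top (fun X : flow => (Pp X : cg_space)) mg_map mg_map1 mg_mapM.

End MergingFunctor.

Section MergingExists.

Lemma compact_hausdorff_subtype (K : topologicalType) (C : set K) :
  compact_hausdorff K -> closed C -> compact_hausdorff C.
Proof.
move=> [cK hK] clC; split.
  move=> F PF _.
  have [|k [_ Fk]] := cK (set_val @ F) _; first exact: filterT.
  have Ck : C k.
    rewrite (closure_id C).1// => B nB.
    have [|z [Cz Bz]] := Fk C B _ nB; last by exists z.
    by apply: (@filterS _ F _ setT); [move=> z _; exact: set_valP | exact: filterT].
  exists (exist _ k (mem_set Ck)); split=> // A B FA.
  move=> [_ [[W oW <-] /= Wk] WB].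
  have FA' : (set_val @ F) (set_val @` A).
    by apply: (@filterS _ F _ A) => [a Aa|//]; exists a.
  have nW : nbhs k W by exact: open_nbhs_nbhs.
  have [_ [[a Aa <-] Wa]] := Fk _ _ FA' nW.
  by exists a; split=> //; exact: WB.
move=> x y xy; apply: val_inj; apply: hK => A B nA nB.
have sv : continuous (set_val : C -> K) by exact: initial_continuous.
have [z [Az Bz]] := xy _ _ (sv _ _ nA) (sv _ _ nB).
by exists (set_val z).
Qed.

Lemma weak_hausdorff_image_closed (Z K : topologicalType) (b : K -> Z)
    (C : set K) : weak_hausdorff Z -> compact_hausdorff K -> continuous b ->
  closed C -> closed (b @` C).
Proof.
move=> wZ hK cb clC.
have -> : b @` C = range (b \o (set_val : C -> K)).
  rewrite eqEsubset; split=> [_ [k Ck <-]|_ [k _ <-]].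
    by exists (exist _ k (mem_set Ck)).
  by exists (set_val k) => //; exact: set_valP.
apply: wZ; first exact: compact_hausdorff_subtype.
move=> x; apply: continuous_comp; [exact: initial_continuous | exact: cb].
Qed.

Lemma weak_hausdorff_closed1 (Z K : topologicalType) (a : K -> Z) (l : K) :
  weak_hausdorff Z -> compact_hausdorff K -> closed [set a l].
Proof.
move=> wZ hK; have -> : [set a l] = range (cst (a l) : K -> Z).
  by rewrite eqEsubset; split=> [_ ->|_ [k _ <-]] //; exists l.
by apply: wZ => // x; exact: cst_continuous.
Qed.

Lemma weak_hausdorff_neq_open (Z L K : topologicalType)
    (a : L -> Z) (b : K -> Z) : weak_hausdorff Z ->
  compact_hausdorff L -> compact_hausdorff K -> continuous a -> continuous b ->
  open [set lk : L * K | a lk.1 <> b lk.2].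
Proof.
move=> wZ hL hK ca cb; rewrite openE => -[l0 k0] /= neq.
have clF : closed (b @^-1` [set a l0]).
  by apply: closed_comp => [z _|]; [exact: cb | exact: weak_hausdorff_closed1].
have [cK hsK] := hK.
have nF : nbhs k0 (~` (b @^-1` [set a l0])).
  by apply: open_nbhs_nbhs; split; [exact: closed_openC | move=> /= /esym].
have nK : nbhs k0 [set: K] by exact: filterT.
have [V nV VF] := @compact_regular K k0 _ hsK cK nK _ nF.
have clV := weak_hausdorff_image_closed wZ hK cb (@closed_closure _ V).
have nO : nbhs l0 (a @^-1` (~` (b @` closure V))).
  apply: ca; apply: open_nbhs_nbhs; split; first exact: closed_openC.
  by move=> [k Vk ak]; exact: VF Vk ak.
exists (a @^-1` (~` (b @` closure V)), V) => // -[l k] /= [nab Vk] ab.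
by apply: nab; exists k => //; exact: subset_closure.
Qed.

Variable X : flow.

(* x and y are identified by the universal map iff they are identified by every
   map satisfying the relations. *)
Definition merge_rel (x y : Psp X) : bool :=
  `[< forall (Z : cg_space) (phi : continuousType (Psp X) Z),
        merging_map phi -> phi x = phi y >].

Lemma merge_rel_equiv : equiv_class_of merge_rel.
Proof.
split=> [x|x y|y x z]; first by apply/asboolP.
  by apply/asboolP/asboolP => h Z phi /h.
by move=> /asboolP xy /asboolP yz; apply/asboolP => Z phi hphi; rewrite xy ?yz.
Qed.

Canonical merge_equiv := EquivRelPack merge_rel_equiv.

Local Open Scope quotient_scope.

Definition merge_quot := quotient_topology {eq_quot merge_equiv}.

Let q : Psp X -> merge_quot := \pi_merge_quot.

Let qE (x y : Psp X) : (q x = q y) <-> merge_rel x y.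
Proof. by split=> [/eqquotP|h]; [|apply/eqquotP]. Qed.

Let q_cts : continuous q. Proof. exact: pi_continuous. Qed.

Let q_surj (z : merge_quot) : exists x, q x = z.
Proof. by exists (repr z); exact: reprK. Qed.

Lemma merge_quot_kspace : is_kspace merge_quot.
Proof.
move=> A kA; apply: (@cg_kspace (Psp X)) => K u hK cu.
apply: (kA K (q \o u) hK) => x; apply: continuous_comp; [exact: cu|exact: q_cts].
Qed.

Lemma merge_quot_desc (Z : cg_space) (phi : continuousType (Psp X) Z) :
  merging_map phi ->
  exists psi : continuousType merge_quot Z, forall x, psi (q x) = phi x.
Proof.
move=> hphi; have E x : phi (repr (q x)) = phi x.
  by have /qE/asboolP : q (repr (q x)) = q x by [exact: reprK]; apply.
have c : continuous (phi \o (repr : merge_quot -> Psp X)).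
  apply/quotient_continuous; rewrite (_ : _ \o _ = phi); first exact: cts_fun.
  by apply/funext => x /=; exact: E.
by exists [the continuousType _ _ of mkcts c] => x; exact: E.
Qed.

Lemma merge_quot_weak_hausdorff : weak_hausdorff merge_quot.
Proof.
move=> K u hK cu; rewrite -openC; apply: (@cg_kspace (Psp X)) => L v hL cv.
rewrite -closedC.
pose D := [set lk : L * K | q (v lk.1) = u lk.2].
have clD : closed D.
  rewrite -openC openE => -[l k] /= nD.
  have [x ux] := q_surj (u k).
  have nmr : ~ merge_rel (v l) x by move=> /qE; rewrite ux => /nD.
  have [Z [phi [hphi ne]]] : exists (Z : cg_space)
      (phi : continuousType (Psp X) Z), merging_map phi /\ phi (v l) <> phi x.
    apply: contrapT => nex; apply: nmr; apply/asboolP => Z phi hphi.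
    by apply: contrapT => ne; apply: nex; exists Z, phi.
  have [psi psiE] := merge_quot_desc hphi.
  have : open [set lk : L * K | phi (v lk.1) <> psi (u lk.2)].
    apply: (@weak_hausdorff_neq_open Z L K (phi \o v) (psi \o u)) => //.
    - exact: cg_weak_hausdorff.
    - by move=> ?; apply: continuous_comp; [exact: cv | exact: cts_fun].
    - by move=> ?; apply: continuous_comp; [exact: cu | exact: cts_fun].
  rewrite openE => /(_ (l, k)) /= H.
  apply: filterS (H _) => [[l' k'] /= ne' e'|].
    by apply: ne'; rewrite -e' psiE.
  by rewrite -ux psiE.
have -> : ~` (v @^-1` (q @^-1` (~` range u))) = fst @` D.
  rewrite eqEsubset; split=> [l /= /contrapT [k _ uk]|_ [[l k] /= e <-]].
    by exists (l, k).
  by apply; exists k.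
have [cL hsL] := hL; have [cK _] := hK.
apply: compact_closed => //; apply: continuous_compact.
  by apply: continuous_subspaceT => x; exact: cvg_fst.
apply: (subclosed_compact clD (compact_setX cL cK)) => x _.
exact: (conj I I).
Qed.

Lemma merging_space_exists : inhabited (merging_space X).
Proof.
pose P := CGSpace merge_quot_kspace merge_quot_weak_hausdorff.
pose h : continuousType (Psp X) P := [the continuousType _ _ of mkcts q_cts].
apply: inhabits; apply: (@MergingSpace X P h).
  by move=> x y e; apply/qE/asboolP => Z phi; exact.
move=> Z phi hphi; have [psi psiE] := merge_quot_desc hphi.
exists psi; split; first exact/continuousEP.
move=> chi /continuousEP chiE; apply/continuousEP => z.
by have [x <-] := q_surj z; rewrite psiE -chiE.
Qed.

End MergingExists.

(* Main.v *)
Require Import Defs.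
From mathcomp Require Import all_boot all_order all_algebra.
From mathcomp Require Import all_classical all_reals topology normedtype.

(** The functor P^+ has a right adjoint, which sends a space Z to the flow with
    one state, path space Z and composition law x * y = y: a morphism of flows
    from X to it is exactly a continuous map phi on PX with
    phi y = phi (x * y).  On path spaces the right adjoint does not change the
    maps, so that it preserves fibrations and trivial fibrations; cofibrations
    and trivial cofibrations being characterized by lifting properties, P^+
    preserves them. *)

Set Implicit Arguments.
Unset Strict Implicit.
Unset Printing Implicit Defensive.

Local Open Scope classical_set_scope.

Section RetractArgument.
Variables (C : category) (M : model_structure C).

(** The retract argument: lifting [idc b] along [p] gives a section of [p] that carries [f] to [i],
    with the source [a] held fixed. *)
Lemma retract_of_lifting (a b c : C) (f : mor a b) (i : mor a c)
    (p : mor c b) : f = compc p i -> has_lifting f p -> retract_of f i.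
Proof.
move=> fpi /(_ i (idc b)) [|l [li pl]]; first by rewrite comp1c -fpi.
by exists (idc a), (idc a), l, p; split; rewrite ?compc1.
Qed.

Lemma cof_of_lifting (a b : C) (f : mor a b) :
  (forall (c d : C) (p : mor c d), fib M p -> weq M p -> has_lifting f p) ->
  cof M f.
Proof.
move=> lift; have [c [i [p [fpi cofi fibp weqp]]]] := cof_tfib_fact M f.
by apply: cof_retract cofi; apply: (retract_of_lifting fpi); exact: lift.
Qed.

Lemma tcof_of_lifting (a b : C) (f : mor a b) :
  (forall (c d : C) (p : mor c d), fib M p -> has_lifting f p) ->
  cof M f /\ weq M f.
Proof.
move=> lift; have [c [i [p [fpi cofi weqi fibp]]]] := tcof_fib_fact M f.
have fi := retract_of_lifting fpi (lift _ _ _ fibp).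
by split; [exact: cof_retract fi cofi | exact: weq_retract fi weqi].
Qed.

End RetractArgument.

Section QuillenAdjunction.
Variables (C D : category) (F : functor C D) (G : functor D C).
Variable FG : adjunction F G.

(** Naturality makes the adjoint transpose of a commuting square commute. The lift found there
    transposes back, and injectivity of [adj] yields the two triangles. *)
Lemma adjunction_lifting (a b : C) (c d : D) (i : mor a b) (p : mor c d) :
  has_lifting i (fhom G p) -> has_lifting (fhom F i) p.
Proof.
move=> lift u v puvi.
have [|l [li pl]] := lift (adj FG u) (adj FG v).
  by rewrite -adj_natr puvi adj_natl.
have [g _ adjK] := adj_bij FG b c.
exists (g l); split.
  by apply: (bij_inj (adj_bij FG a c)); rewrite adj_natl adjK.
by apply: (bij_inj (adj_bij FG b d)); rewrite adj_natr adjK.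
Qed.

Lemma left_Quillen_of_right (M : model_structure C) (N : model_structure D) :
  (forall (c d : D) (p : mor c d), fib N p -> fib M (fhom G p)) ->
  (forall (c d : D) (p : mor c d),
    fib N p -> weq N p -> weq M (fhom G p)) ->
  left_Quillen M N F.
Proof.
move=> Gfib Gtfib; split; first by exists G; exact: inhabits FG.
  move=> a b f coff; apply: cof_of_lifting => c d p fibp weqp.
  by apply: adjunction_lifting; apply: (cof_tfib_lift coff); auto.
move=> a b f coff weqf; apply: tcof_of_lifting => c d p fibp.
by apply: adjunction_lifting; apply: (tcof_fib_lift coff); auto.
Qed.

End QuillenAdjunction.

Section RightZeroFlow.

Definition to_unit (Z : topologicalType) : continuousType Z (discrete_topology unit) :=
  [the continuousType Z (discrete_topology unit) of cst tt].

Section Composition.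
Variable Z : cg_space.

Definition second_path (xy : kification (composable (to_unit Z) (to_unit Z))) :
  Z := (set_val xy).2.

Lemma second_path_continuous : continuous second_path.
Proof.
(* Openness in the k-ification is tested along maps [u] from compact Hausdorff spaces; these are
   continuous for the subspace topology of the product, where the second projection is
   continuous. *)
apply/continuousP => A oA; rewrite kification_openE => K u _ cu.
have c2 : continuous
    (snd \o (set_val : composable (to_unit Z) (to_unit Z) -> (Z * Z)%type)).
  move=> x; apply: continuous_comp; first exact: initial_continuous.
  exact: cvg_snd.
by move/continuousP: cu; apply; move/continuousP: c2; apply.
Qed.

End Composition.

(** With a single state all pairs of paths compose, and both bracketings of a triple reduce to its
    last factor. *)
Definition right_zero_flow (Z : cg_space) : flow.
Proof.
by refine (@Flow Z (discrete_topology unit) (to_unit Z) (to_unit Z)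
  [the continuousType _ _ of mkcts (@second_path_continuous Z)] _ _ _).
Defined.

Definition right_zero_map (Z W : cg_space) (f : continuousType Z W) :
  flow_mor (right_zero_flow Z) (right_zero_flow W).
Proof.
by refine (@FlowMor (right_zero_flow Z) (right_zero_flow W) id f _ _ _).
Defined.

Definition right_zero_functor : functor Top Flows.
Proof.
by refine (@Functor Top Flows right_zero_flow right_zero_map _ _) => *;
  exact: flow_mor_eq.
Defined.

End RightZeroFlow.

Section MergingAdjunction.
Variable Pp : forall X : flow, merging_space X.

Definition merging_adj (X : flow) (Z : cg_space) (h : continuousType (Pp X) Z) :
  flow_mor X (right_zero_flow Z).
Proof.
refine (@FlowMor X (right_zero_flow Z) (fun=> tt) (cts_comp h (mg_h (Pp X)))
  _ _ _) => // x y e e' /=.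
by rewrite -(mg_hP _ e).
Defined.

Lemma merging_adj_bij (X : flow) (Z : cg_space) : bijective (@merging_adj X Z).
Proof.
have mm (f : flow_mor X (right_zero_flow Z)) : merging_map (fm_path f).
  by move=> x y e; rewrite (fm_cat e (fm_composable f e)).
(* The inverse is the factorization through [mg_h]: its uniqueness gives one identity, its existence
   the other. *)
exists (fun f => projT1 (cid (mg_univ (Pp X) (mm f)))) => [h|f].
  by case: cid => psi /= [_]; exact.
case: cid => psi /= [psiE _]; apply: flow_mor_eq => //.
(* A map of states into [unit] is forced. *)
by apply/funext => x /=; case: (fm_states f x).
Qed.

Definition merging_adjunction :
  adjunction (merging_functor Pp) right_zero_functor.
Proof.
refine (@Adjunction _ _ (merging_functor Pp) right_zero_functor
  merging_adj merging_adj_bij _ _) => [Y X Z h f|X Z W h k];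
  apply: flow_mor_eq => //=.
  by rewrite -cts_compA mg_mapE cts_compA.
by rewrite cts_compA.
Defined.

End MergingAdjunction.

Theorem theoremA4 (R : realType)
  (MTop : model_structure Top)
  (MTop_weq : forall (X Y : Top) (f : mor X Y),
     weq MTop f <-> weak_homotopy_equivalence R f)
  (MTop_fib : forall (X Y : Top) (f : mor X Y),
     fib MTop f <-> Serre_fibration R f)
  (MFlow : model_structure Flows)
  (MFlow_weq : forall (X Y : Flows) (f : mor X Y),
     weq MFlow f <-> weak_S_homotopy_equivalence R f)
  (MFlow_fib : forall (X Y : Flows) (f : mor X Y),
     fib MFlow f <-> flow_fibration R f)
  (Pplus : forall X : flow, merging_space X) :
  left_Quillen MFlow MTop (merging_functor Pplus).
Proof.
apply: (left_Quillen_of_right (merging_adjunction Pplus)) => Z W p.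
  by move=> /MTop_fib fibp; apply/MFlow_fib.
move=> _ /MTop_weq weqp; apply/MFlow_weq; split=> //.
(* What remains is bijectivity on states, where the right adjoint acts as the identity. *)
by exists id.
Qed.
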